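(* Let $F$ be a graph with at least two vertices and let $r\ge 2$ be an integer, and set $k=\min\{r-1,|V(F)|-1\}$. Then, as $n\to\infty$, $$\mathrm{ex}_r(n,\text{Berge-}F)\le (|E(F)|-1)\,\mathrm{ex}(n,K_3,F)+\mathrm{ex}(n,K_r,F)+\frac{(|E(F)|-1)\,\mathrm{ex}(n,F)}{k(r-k)}+o(n^2).$$
   Context: For a graph $F$ and a hypergraph $\mathcal H$, $\mathcal H$ contains a Berge copy of $F$ (a Berge-$F$) if there is an injection $\varphi:V(F)\to V(\mathcal H)$ and an injection $f:E(F)\to E(\mathcal H)$ such that for every edge $xy\in E(F)$, $\{\varphi(x),\varphi(y)\}\subseteq f(xy)$. $\mathrm{ex}_r(n,\text{Berge-}F)$ denotes the maximum number of hyperedges in an $n$-vertex $r$-uniform hypergraph containing no Berge-$F$. $\mathrm{ex}(n,F)$ is the maximum number of edges of an $n$-vertex graph containing no subgraph isomorphic to $F$, and for a graph $H$, $\mathrm{ex}(n,H,F)$ is the maximum number of (not necessarily induced) copies of $H$ in an $n$-vertex graph containing no copy of $F$. *)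

(* Defs.v *)
From mathcomp Require Import all_boot all_order all_algebra.
Set Implicit Arguments. Unset Strict Implicit. Unset Printing Implicit Defensive.

Definition is_graph (T : finType) (E : {set {set T}}) : bool :=
  [forall e in E, #|e| == 2].

Definition is_uniform (T : finType) (r : nat) (H : {set {set T}}) : bool :=
  [forall e in H, #|e| == r].

Definition contains_copy (T U : finType) (E : {set {set T}}) (G : {set {set U}}) : bool :=
  [exists phi : {ffun T -> U}, injectiveb phi && [forall e in E, (phi @: e) \in G]].

Definition contains_berge (T U : finType) (E : {set {set T}}) (H : {set {set U}}) : bool :=
  [exists phi : {ffun T -> U}, exists f : {ffun {set T} -> {set U}},
    [&& injectiveb phi,
        [forall e in E, f e \in H],
        [forall e in E, forall e' in E, (f e == f e') ==> (e == e')] &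
        [forall e in E, (phi @: e) \subset f e]]].

Definition is_clique (U : finType) (G : {set {set U}}) (S : {set U}) : bool :=
  [forall x in S, forall y in S, (x != y) ==> ([set x; y] \in G)].

Definition num_cliques (U : finType) (s : nat) (G : {set {set U}}) : nat :=
  #|[set S : {set U} | (#|S| == s) && is_clique G S]|.

Definition ex (n : nat) (T : finType) (E : {set {set T}}) : nat :=
  \max_(G : {set {set 'I_n}} | is_graph G && ~~ contains_copy E G) #|G|.

Definition ex_clique (n s : nat) (T : finType) (E : {set {set T}}) : nat :=
  \max_(G : {set {set 'I_n}} | is_graph G && ~~ contains_copy E G) num_cliques s G.

Definition ex_berge (r n : nat) (T : finType) (E : {set {set T}}) : nat :=
  \max_(H : {set {set 'I_n}} | is_uniform r H && ~~ contains_berge E H) #|H|.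

(* Main.v *)
Require Import Defs.
From mathcomp Require Import all_boot all_order all_algebra zify ring lra.
From Stdlib Require Import Classical.
Set Implicit Arguments. Unset Strict Implicit. Unset Printing Implicit Defensive.
Import Order.TTheory GRing.Theory Num.Theory.

(* Call a pair of vertices heavy if at least |E(F)| hyperedges contain it, and light
   if fewer, but at least one, do.  The heavy graph is F-free, since a copy of F in it
   extends greedily to a Berge-F; hence at most ex(n,K_r,F) hyperedges are heavy
   cliques.  If a hyperedge contains a light pair xz that closes a heavy path xyz, it
   is charged to the triangle xyz, which gives at most (|E(F)|-1) ex(n,K_3,F) of them.
   In every other hyperedge the heavy pairs form disjoint cliques with at most k
   vertices each, so that at least k(r-k) of its pairs are light.
   It remains to see that there are at most ex(n,F) + o(n^2) light pairs.  Only
   O(n^2) hyperedges contain a light pair, so a random map from a fixed set of m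
   vertices is, up to probability O(1/n), injective with no three images in one of
   these hyperedges.  The light pairs then pull back to an F-free graph, and so the
   density of the light pairs is at most ex(m,F)/C(m,2) + O(1/n). *)

(** * Graphs as sets of two-element sets *)

Lemma graph_card2 (U : finType) (G : {set {set U}}) p :
  is_graph G -> p \in G -> #|p| = 2.
Proof. by move=> /forall_inP gG /gG /eqP. Qed.

Lemma set2_eq (U : finType) (a b x y : U) :
  [set x; y] = [set a; b] -> (x, y) = (a, b) \/ (x, y) = (b, a).
Proof.
move=> eq_xy.
have : x \in [set a; b] by rewrite -eq_xy set21.
have : y \in [set a; b] by rewrite -eq_xy set22.
have : a \in [set x; y] by rewrite eq_xy set21.
have : b \in [set x; y] by rewrite eq_xy set22.
rewrite !inE => /orP[]/eqP b_xy /orP[]/eqP a_xy /orP[]/eqP y_ab /orP[]/eqP x_ab;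
  by [left; congr pair; congruence | right; congr pair; congruence].
Qed.

(** The fibre over an edge with ends [a], [b] consists of [(a, b)] and [(b, a)]. Ordered pairs are
    easier to count, both for pulled-back edges and for light pairs in a hyperedge. *)
Lemma card_graph_pairs (U : finType) (G : {set {set U}}) :
  is_graph G -> #|[set q : U * U | [set q.1; q.2] \in G]| = 2 * #|G|.
Proof.
move=> gG; rewrite -sum1_card.
under eq_bigl do rewrite inE.
rewrite (partition_big (fun q : U * U => [set q.1; q.2]) (mem G)) //=.
rewrite mulnC -sum_nat_const; apply: eq_bigr => p pG.
have /cards2P[a [b [neq_ab pE]]] : #|p| == 2 by rewrite (graph_card2 gG).
rewrite {}pE in pG *.
rewrite -[RHS](_ : #|[set (a, b); (b, a)]| = 2); last first.
  by rewrite cards2 xpair_eqE (negPf neq_ab).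
rewrite -sum1_card; apply: eq_bigl => -[x y] /=; rewrite !inE.
apply/andP/orP => [[_ /eqP/set2_eq[]-> ]|[]/eqP[-> ->]].
- by left; rewrite eqxx.
- by right; rewrite eqxx.
- by split.
- by rewrite setUC.
Qed.

(** * Heavy and light pairs, and the greedy construction of Berge copies *)

Definition codeg (U : finType) (H : {set {set U}}) (p : {set U}) : nat :=
  #|[set h in H | p \subset h]|.

Definition heavy (U : finType) (m : nat) (H : {set {set U}}) : {set {set U}} :=
  [set p : {set U} | (#|p| == 2) && (m <= codeg H p)].

(** Positive codegree keeps the light pairs inside the shadow of [H], so that a copy of F among them
    can be lifted to hyperedges. *)
Definition light (U : finType) (m : nat) (H : {set {set U}}) : {set {set U}} :=
  [set p : {set U} | (#|p| == 2) && (0 < codeg H p < m)].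

(** [D] holds the edges that already have a hyperedge, namely [g e]. The remaining ones are served
    one at a time, by induction on their number. Starting from an arbitrary [D] covers both the
    purely greedy case and the case where all hyperedges are prescribed. *)
Lemma greedy_berge (T U : finType) (E : {set {set T}}) (H : {set {set U}})
    (phi : {ffun T -> U}) (D : {set {set T}}) (g : {set T} -> {set U}) :
  injective phi -> D \subset E -> {in D &, injective g} ->
  {in D, forall e, g e \in H /\ phi @: e \subset g e} ->
  {in E, forall e, e \notin D -> #|E| <= codeg H (phi @: e)} ->
  contains_berge E H.
Proof.
move=> phi_inj; have [n le_n] := ubnP #|E :\: D|.
elim: n D g le_n => // n IHn D g le_n sDE g_inj gH rich.
have [/eqP|[e]] := set_0Vmem (E :\: D).
  rewrite setD_eq0 => sED; have eDE : D = E by apply/eqP; rewrite eqEsubset sDE.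
  subst D; apply/existsP; exists phi; apply/existsP; exists [ffun e => g e].
  apply/and4P; split; first exact/injectiveP.
  - by apply/forall_inP => e eE; rewrite ffunE; case: (gH e eE).
  - apply/forall_inP => e eE; apply/forall_inP => e' eE'; rewrite !ffunE.
    by apply/implyP => /eqP /g_inj ->.
  - by apply/forall_inP => e eE; rewrite ffunE; case: (gH e eE).
rewrite inE => /andP[eD eE].
(* At most [#|D|] hyperedges are taken and [#|D| < #|E|], so one of the at least [#|E|] hyperedges
   containing the image of [e] is still free. *)
have [h] : exists h, h \in [set h in H | phi @: e \subset h] :\: g @: D.
  apply/set0Pn; rewrite setD_eq0; apply/negP => /subset_leq_card.
  apply/negP; rewrite -ltnNge.
  apply: leq_trans _ (rich e eE eD); apply: leq_ltn_trans (leq_imset_card _ _) _.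
  by apply: proper_card; apply/properP; split=> //; exists e.
rewrite !inE => /and3P[hD hH eh].
have neD e' : e' \in D -> (e' == e) = false.
  by move=> e'D; apply: contraNF eD => /eqP <-.
apply: (IHn (e |: D) (fun e' => if e' == e then h else g e')).
- apply: leq_trans _ (ltnSE le_n); apply: proper_card; apply/properP; split.
    by apply: setDS; apply: subsetUr.
  by exists e; rewrite !inE ?eqxx ?eD.
- by rewrite subUset sub1set eE.
- move=> e1 e2; rewrite !inE.
  case/predU1P => [->|e1D]; case/predU1P => [->|e2D]; rewrite ?eqxx ?neD //.
  + by move=> hE; case/negP: hD; rewrite hE imset_f.
  + by move=> hE; case/negP: hD; rewrite -hE imset_f.
  + exact: g_inj.
- move=> e'; rewrite !inE; case/predU1P => [->|e'D]; first by rewrite eqxx.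
  by rewrite neD //; apply: gH.
- by move=> e' e'E; rewrite !inE negb_or => /andP[_]; apply: rich.
Qed.

(** The map [g] gives the pairs in [P] distinct representatives among the hyperedges. In a copy of
    F, the edges landing in [P] receive these, and all others land on heavy pairs and are served
    greedily. *)
Lemma heavyU_free (T U : finType) (E : {set {set T}}) (H P : {set {set U}})
    (g : {set U} -> {set U}) :
  ~~ contains_berge E H -> {in P &, injective g} ->
  {in P, forall p, g p \in H /\ p \subset g p} ->
  ~~ contains_copy E (heavy #|E| H :|: P).
Proof.
move=> Hfree g_inj gP; apply: contra Hfree => /existsP[phi /andP[/injectiveP phi_inj]].
move=> /forall_inP copy.
apply: (greedy_berge (phi := phi) (D := [set e in E | phi @: e \in P])
          (g := fun e => g (phi @: e))) => //.
- by apply/subsetP => e; rewrite inE => /andP[].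
- move=> e1 e2; rewrite !inE => /andP[_ P1] /andP[_ P2] /(g_inj _ _ P1 P2).
  exact: imset_inj.
- by move=> e; rewrite inE => /andP[_ /gP].
- move=> e eE; rewrite inE eE /= => nP.
  by have := copy e eE; rewrite !inE (negPf nP) orbF => /andP[].
Qed.

Lemma heavy_free (T U : finType) (E : {set {set T}}) (H : {set {set U}}) :
  ~~ contains_berge E H -> ~~ contains_copy E (heavy #|E| H).
Proof.
move=> Hfree; rewrite -[heavy _ _]setU0.
by apply: (heavyU_free (g := id)) => // ?; rewrite inE.
Qed.

Lemma heavy_graph (U : finType) m (H : {set {set U}}) : is_graph (heavy m H).
Proof. by apply/forall_inP => p; rewrite inE => /andP[]. Qed.

Lemma light_graph (U : finType) m (H : {set {set U}}) : is_graph (light m H).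
Proof. by apply/forall_inP => p; rewrite inE => /andP[]. Qed.

Lemma light_heavyF (U : finType) m (H : {set {set U}}) p :
  p \in light m H -> p \in heavy m H -> False.
Proof. by rewrite !inE => /and3P[_ _ lt] /andP[_]; rewrite leqNgt lt. Qed.

Lemma pair_heavy_light (U : finType) m (H : {set {set U}}) h x y :
  h \in H -> x \in h -> y \in h -> x != y ->
  [set x; y] \notin heavy m H -> [set x; y] \in light m H.
Proof.
move=> hH xh yh nxy; rewrite !inE cards2 nxy /= -ltnNge => ->.
rewrite andbT; apply/card_gt0P; exists h.
by rewrite inE hH subUset !sub1set xh yh.
Qed.

(** * Copies inside cliques, and pairs across the classes of an equivalence relation *)

Lemma embed_into (T U : finType) (S : {set U}) :
  #|T| <= #|S| -> exists2 phi : {ffun T -> U}, injective phi & forall t, phi t \in S.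
Proof.
move=> le; exists [ffun t => enum_val (widen_ord le (enum_rank t))].
  move=> x y; rewrite !ffunE => /enum_val_inj /(congr1 val) /= /val_inj.
  exact: enum_rank_inj.
by move=> t; rewrite ffunE enum_valP.
Qed.

(** Any injection into a clique preserves edges. Applied to the F-free heavy graph, this keeps heavy
    cliques below [#|T|] vertices. *)
Lemma clique_copy (T U : finType) (E : {set {set T}}) (G : {set {set U}}) S :
  is_graph E -> is_clique G S -> #|T| <= #|S| -> contains_copy E G.
Proof.
move=> gE /forall_inP clS /embed_into[phi phi_inj phiS].
apply/existsP; exists phi; apply/andP; split; first exact/injectiveP.
apply/forall_inP => e eE.
have /cards2P[a [b [nab ->]]] : #|e| == 2 by rewrite (graph_card2 gE).
rewrite imsetU1 imset_set1.
by apply: (implyP (forall_inP (clS _ _) _ _)) => //; rewrite (inj_eq phi_inj).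
Qed.

(** The extreme case is one class of size [k] and one of size [#|h| - k], whose cross pairs, taken
    in both orders, give the bound. The proof distinguishes whether [2 * k <= #|h|], whether all
    classes have at most [#|h| - k] elements, or whether some class is larger than that. *)
Lemma card_cross_classes (U : finType) (h : {set U}) (R : rel U) (k : nat) :
  {in h &, symmetric R} -> {in h & &, transitive R} -> {in h, reflexive R} ->
  {in h, forall x, #|[set y in h | R x y]| <= k} -> k <= #|h| ->
  2 * (k * (#|h| - k)) <=
    #|[set q : U * U | [&& q.1 \in h, q.2 \in h & ~~ R q.1 q.2]]|.
Proof.
move=> Rsym Rtr Rrefl classk le_kh.
pose cl x := [set y in h | R x y].
have -> : #|[set q : U * U | [&& q.1 \in h, q.2 \in h & ~~ R q.1 q.2]]| =
          \sum_(x in h) #|h :\: cl x|.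
  rewrite -sum1_card; under eq_bigl do rewrite inE.
  rewrite (eq_bigr (fun x => \sum_(y in h :\: cl x) 1)); last first.
    by move=> x _; rewrite sum1_card.
  rewrite pair_big_dep /=; apply: eq_bigl => -[x y] /=; rewrite !inE.
  by case: (y \in h); rewrite ?andbF ?andbT.
have clE x : #|h :\: cl x| = #|h| - #|cl x|.
  by apply: cardsDS; apply/subsetP => y; rewrite inE => /andP[].
have [le_2k|lt_2k] := leqP (2 * k) #|h|.
  apply: (@leq_trans (\sum_(x in h) (#|h| - k))); last first.
    by apply: leq_sum => x xh; rewrite clE leq_sub2l // classk.
  by rewrite sum_nat_const mulnA leq_mul2r le_2k orbT.
have [/forall_inP small|/forall_inPn[x xh big]] :=
    boolP [forall x in h, #|cl x| <= #|h| - k].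
  (* Every element has at least [k] partners outside its class, and [2 * (#|h| - k) <= #|h|] because
     [#|h| < 2 * k]. *)
  apply: (@leq_trans (\sum_(x in h) k)).
    by rewrite sum_nat_const; nia.
  by apply: leq_sum => x xh; rewrite clE; have := small x xh; lia.
rewrite -ltnNge in big.
have clh : cl x \subset h by apply/subsetP => y; rewrite inE => /andP[].
rewrite (bigID (mem (cl x))) /=.
(* Only pairs between the large class, of size c, and its complement are counted. With s the size of
   [h], c(s - c) - k(s - k) = (k - c)(c + k - s), which is nonnegative since s - k < c <= k. *)
apply: (@leq_trans (\sum_(y in cl x) (#|h| - #|cl x|) +
                    \sum_(y in h :\: cl x) #|cl x|)).
  rewrite !sum_nat_const cardsDS //.
  have := classk x xh; rewrite -/(cl x) => le_ck.
  by nia.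
apply: leq_add.
  rewrite [leqRHS](eq_bigl (mem (cl x))); last first.
    by move=> y /=; rewrite !inE; case: (y \in h).
  apply: leq_sum => y; rewrite inE => /andP[yh xy].
  rewrite -cardsDS //; apply: subset_leq_card.
  apply/subsetP => z; rewrite !inE; case zh: (z \in h); rewrite ?andbF //= !andbT.
  by apply: contra; apply: Rtr.
rewrite [leqRHS](eq_bigl (mem (h :\: cl x))); last first.
  by move=> y /=; rewrite !inE andbC.
apply: leq_sum => y; rewrite !inE => /andP[nxy yh].
apply: subset_leq_card; apply/subsetP => z; rewrite !inE => /andP[zh xz].
rewrite zh andbT /=; apply: contra nxy => yz; rewrite yh /=.
by apply: (Rtr z) => //; rewrite Rsym.
Qed.

(** * Counting maps between finite sets, and elementary bounds *)

Lemma card_ffun_family (I U : finType) (A : I -> {set U}) :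
  #|[set phi : {ffun I -> U} | [forall i, phi i \in A i]]| = \prod_i #|A i|.
Proof.
rewrite cardsE.
have -> : \prod_i #|A i| = #|family (fun i => mem (A i))|.
  by rewrite card_family foldrE big_map big_enum.
by apply: eq_card => phi; rewrite !inE.
Qed.

Lemma card_maps_into (I U : finType) (D : {set I}) (A : {set U}) :
  #|[set phi : {ffun I -> U} | phi @: D \subset A]| = #|A| ^ #|D| * #|U| ^ (#|I| - #|D|).
Proof.
transitivity (\prod_i #|if i \in D then A else [set: U]|).
  rewrite -card_ffun_family; apply: eq_card => phi; rewrite !inE.
  apply/subsetP/forallP => [sA i|sA _ /imsetP[i iD ->]].
    by case: ifP => // iD; apply: sA; apply: imset_f.
  by have := sA i; rewrite iD.
rewrite (bigID (mem D)) /=; congr (_ * _).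
  by rewrite (eq_bigr (fun=> #|A|)) ?prod_nat_const // => i ->.
rewrite (eq_bigr (fun=> #|U|)); last by move=> i /negPf ->; rewrite cardsT.
rewrite prod_nat_const; congr (_ ^ _); rewrite -[in RHS](setCK D) -cardsCs.
by apply: eq_card => i; rewrite !inE.
Qed.

Lemma card_maps_pair (I U : finType) (i j : I) (x y : U) : i != j ->
  #|[set phi : {ffun I -> U} | (phi i == x) && (phi j == y)]| = #|U| ^ (#|I| - 2).
Proof.
move=> nij.
pose A l := if l == i then [set x] else if l == j then [set y] else setT.
rewrite (_ : [set _ | _] = [set phi : {ffun I -> U} | [forall l, phi l \in A l]]).
  rewrite card_ffun_family (bigD1 i) // (bigD1 j) 1?eq_sym //= /A eqxx cards1.
  rewrite eq_sym (negPf nij) eqxx cards1 !mul1n.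
  rewrite (eq_bigr (fun=> #|U|)); last first.
    by move=> l /andP[/negPf -> /negPf ->]; rewrite cardsT.
  rewrite prod_nat_const; congr (_ ^ _).
  have -> : #|I| - 2 = #|~: [set i; j]| by rewrite cardsCs setCK cards2 nij.
  by apply: eq_card => l; rewrite !inE negb_or.
apply/setP => phi; rewrite !inE; apply/andP/forallP => [[/eqP xi /eqP yj] l|all].
  by rewrite /A; case: eqP => [->|_]; [|case: eqP => [->|_]]; rewrite inE ?xi ?yj.
have := all i; have := all j; rewrite /A eqxx eq_sym (negPf nij) eqxx !inE.
by move=> -> ->.
Qed.

(* Otherwise [b] would drop by [eps] again and again; no monotonicity is needed,
   which spares the existence of the Turan density. *)
Lemma almost_min (b : nat -> rat) (eps : rat) (m0 : nat) :
  (forall n, 0 <= b n)%R -> (0 < eps)%R ->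
  exists2 m, m0 <= m & forall n, m <= n -> (b m <= b n + eps)%R.
Proof.
move=> b_ge0 eps_gt0.
suff drop t : forall m, m0 <= m -> (b m < eps * t%:R)%R ->
    exists2 m, m0 <= m & forall n, m <= n -> (b m <= b n + eps)%R.
  apply: (drop (Num.bound (b m0 / eps)) m0) => //.
  rewrite mulrC -ltr_pdivrMr //; apply: archi_boundP.
  by rewrite divr_ge0 // ltW.
elim: t => [|t IH] m le_m; first by rewrite mulr0 ltNge b_ge0.
move=> bm; have [?|] := classic (forall n, m <= n -> (b m <= b n + eps)%R).
  by exists m.
move=> /not_all_ex_not[n /(imply_to_and (m <= n)) nle].
have [le_mn /negP lt_b] := nle; rewrite -ltNge in lt_b.
apply: (IH n); first exact: leq_trans le_mn.
by move: bm; rewrite -natr1 mulrDr mulr1; lra.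
Qed.

Lemma card_graph_bin (U : finType) (G : {set {set U}}) :
  is_graph G -> #|G| <= 'C(#|U|, 2).
Proof.
move=> gG; rewrite -card_draws; apply: subset_leq_card.
by apply/subsetP => p pG; rewrite inE (graph_card2 gG).
Qed.

Lemma leq_ex (n : nat) (T : finType) (E : {set {set T}}) (G : {set {set 'I_n}}) :
  is_graph G -> ~~ contains_copy E G -> #|G| <= ex n E.
Proof.
by move=> gG freeG; rewrite /ex; apply: (bigop.bigmax_sup G) => //; rewrite gG.
Qed.

Lemma ex_leq_bin (n : nat) (T : finType) (E : {set {set T}}) : ex n E <= 'C(n, 2).
Proof.
apply/bigmax_leqP => G /andP[/card_graph_bin]; by rewrite card_ord.
Qed.

Lemma leq_card_bigcup (I U : finType) (P : pred I) (F : I -> {set U}) :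
  #|\bigcup_(i | P i) F i| <= \sum_(i | P i) #|F i|.
Proof.
elim/big_rec2: _ => [|i m A _ le]; first by rewrite cards0.
by rewrite (leq_trans (leq_card_setU _ _)) // leq_add2l.
Qed.

(** * Averaging the pullback of a graph over all maps *)

Definition pullback (I U : finType) (L : {set {set U}}) (phi : {ffun I -> U}) :
    {set {set I}} := [set D : {set I} | (#|D| == 2) && (phi @: D \in L)].

(** Double counting: a fixed pair of [I] is sent onto an edge of [L] by choosing one of the
    [2 * #|L|] ordered edges as its image and the other values freely. *)
Lemma sum_pullback (I U : finType) (L : {set {set U}}) : is_graph L ->
  \sum_(phi : {ffun I -> U}) #|pullback L phi| =
  'C(#|I|, 2) * (2 * #|L| * #|U| ^ (#|I| - 2)).
Proof.
move=> gL; rewrite -card_draws -sum_nat_const.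
rewrite (eq_bigr (fun phi : {ffun I -> U} =>
    \sum_(D : {set I} | (#|D| == 2) && (phi @: D \in L)) 1)); last first.
  by move=> phi _; rewrite -sum1_card; apply: eq_bigl => D; rewrite inE.
rewrite (exchange_big_dep (fun D : {set I} => #|D| == 2)) /=; last first.
  by move=> ? ? _ /andP[].
rewrite [RHS](eq_bigl (fun D : {set I} => #|D| == 2)); last first.
  by move=> D; rewrite inE.
apply: eq_bigr => D D2; have /cards2P[i [j [nij DE]]] := D2.
rewrite -card_graph_pairs // -sum_nat_const.
rewrite (partition_big (fun phi : {ffun I -> U} => (phi i, phi j))
           (mem [set q : U * U | [set q.1; q.2] \in L])) /=; last first.
  by move=> phi /andP[_]; rewrite inE DE imsetU1 imset_set1.
apply: eq_bigr => -[x y]; rewrite inE /= => xyL.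
rewrite -(card_maps_pair x y nij) -[RHS]sum1_card; apply: eq_bigl => phi.
rewrite inE xpair_eqE D2 /=.
have [/andP[/eqP xi /eqP yj]|] := boolP (_ && (phi j == y)); rewrite ?andbF //.
by rewrite DE imsetU1 imset_set1 xi yj xyL.
Qed.

(* Along any other map, a copy of [F] in the pullback is a Berge copy: two of its
   edges lying in a common hyperedge would put three points there. *)
Definition bad_maps (I U : finType) (H : {set {set U}}) : {set {ffun I -> U}} :=
  (\bigcup_(D : {set I} | #|D| == 2) \bigcup_x
     [set phi : {ffun I -> U} | phi @: D \subset [set x]]) :|:
  (\bigcup_(D : {set I} | #|D| == 3) \bigcup_(h in H)
     [set phi : {ffun I -> U} | phi @: D \subset h]).

(** A union bound. The first term counts maps collapsing some pair to a point, the second those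
    sending some triple into a hyperedge. *)
Lemma card_bad_maps (I U : finType) (H : {set {set U}}) r :
  is_uniform r H ->
  #|bad_maps I H| <= 'C(#|I|, 2) * (#|U| * #|U| ^ (#|I| - 2)) +
                     'C(#|I|, 3) * (#|H| * (r ^ 3 * #|U| ^ (#|I| - 3))).
Proof.
move=> /forall_inP uH; apply: leq_trans (leq_card_setU _ _) (leq_add _ _).
  apply: leq_trans (leq_card_bigcup _ _) _; rewrite -card_draws -sum_nat_const.
  rewrite [leqRHS](eq_bigl (fun D : {set I} => #|D| == 2)); last by move=> D; rewrite inE.
  apply: leq_sum => D /eqP D2; apply: leq_trans (leq_card_bigcup _ _) _.
  rewrite -sum_nat_const; apply: leq_sum => x _.
  by rewrite card_maps_into cards1 exp1n mul1n D2.
apply: leq_trans (leq_card_bigcup _ _) _; rewrite -card_draws -sum_nat_const.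
rewrite [leqRHS](eq_bigl (fun D : {set I} => #|D| == 3)); last by move=> D; rewrite inE.
apply: leq_sum => D /eqP D3; apply: leq_trans (leq_card_bigcup _ _) _.
rewrite -sum_nat_const; apply: leq_sum => h /uH/eqP hr.
by rewrite card_maps_into hr D3.
Qed.

Lemma pullback_free (T I U : finType) (E : {set {set T}}) (H L : {set {set U}})
    (phi : {ffun I -> U}) :
  is_graph E -> ~~ contains_berge E H ->
  (forall p, p \in L -> exists2 h, h \in H & p \subset h) ->
  phi \notin bad_maps I H -> ~~ contains_copy E (pullback L phi).
Proof.
move=> gE Hfree LH; rewrite inE negb_or => /andP[inj_phi good].
have phi_inj : injective phi.
  move=> i j eq_ij; apply/eqP; apply: contraNT inj_phi => nij.
  apply/bigcupP; exists [set i; j]; first by rewrite cards2 nij.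
  by apply/bigcupP; exists (phi i); rewrite // inE imsetU1 imset_set1 -eq_ij setUid.
apply: contra Hfree => /existsP[psi /andP[/injectiveP psi_inj /forall_inP copy]].
pose chi : {ffun T -> U} := [ffun t => phi (psi t)].
have chi_t t : chi t = phi (psi t) by rewrite /chi ffunE.
have chiE (e : {set T}) : chi @: e = phi @: (psi @: e).
  by rewrite -imset_comp; apply: eq_imset.
(* The default [set0] is never taken on [E], since each pair of [L] lies in a hyperedge. *)
pose g (e : {set T}) := odflt set0 [pick h in H | chi @: e \subset h].
have gP e : e \in E -> g e \in H /\ chi @: e \subset g e.
  move=> /copy; rewrite inE -chiE => /andP[_ /LH[h hH eh]].
  by rewrite /g; case: pickP => [? /andP[]//|/(_ h)]; rewrite hH eh.
apply: (greedy_berge (phi := chi) (D := E) (g := g)) => //.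
- by move=> s t; rewrite !chi_t => /phi_inj/psi_inj.
- move=> e e' eE e'E eq_g; apply/eqP; apply: contraNT good => nee'.
  have [t te' nte] : exists2 t, t \in e' & t \notin e.
    apply/subsetPn; apply: contra nee' => se'e.
    by rewrite eq_sym eqEcard se'e (graph_card2 gE eE) (graph_card2 gE e'E).
  apply/bigcupP; exists (psi @: (t |: e)).
    by rewrite card_imset // cardsU1 nte (graph_card2 gE).
  apply/bigcupP; exists (g e); first by case: (gP e eE).
  rewrite inE -chiE imsetU1 subUset sub1set; have [_ ->] := gP e eE.
  have [_ /subsetP sub] := gP e' e'E.
  by rewrite andbT eq_g; apply: sub; apply: imset_f.
- by move=> e eE; rewrite eE.
Qed.

(** Maps that are not bad contribute at most [M] each, by F-freeness of the pullback; bad maps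
    contribute at most all pairs of [I]. *)
Lemma sum_pullback_le (T I U : finType) (E : {set {set T}}) (H L : {set {set U}}) M :
  is_graph E -> ~~ contains_berge E H ->
  (forall p, p \in L -> exists2 h, h \in H & p \subset h) ->
  (forall G : {set {set I}}, is_graph G -> ~~ contains_copy E G -> #|G| <= M) ->
  \sum_(phi : {ffun I -> U}) #|pullback L phi| <=
  #|U| ^ #|I| * M + #|bad_maps I H| * 'C(#|I|, 2).
Proof.
move=> gE Hfree LH exM; rewrite (bigID (mem (bad_maps I H))) /= addnC.
have gP phi : is_graph (pullback L phi).
  by apply/forall_inP => D; rewrite inE => /andP[].
apply: leq_add; last first.
  by rewrite -sum_nat_const; apply: leq_sum => phi _; apply: card_graph_bin.
apply: (@leq_trans (\sum_(phi : {ffun I -> U} | phi \notin bad_maps I H) M)).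
  by apply: leq_sum => phi good; apply: exM => //; apply: pullback_free good.
rewrite sum_nat_const leq_mul2r -card_ffun max_card; exact: orbT.
Qed.

(** This compares the exact and the upper count of pulled-back edges, divided by [n ^ (m - 2)]. With
    at most [c * n ^ 2] hyperedges, the bad maps number O(n^(m-1)), so the error is linear in
    [n]. *)
Lemma shadow_average (T : finType) (E : {set {set T}}) r c m n
    (H L : {set {set 'I_n}}) :
  is_graph E -> ~~ contains_berge E H -> is_uniform r H -> is_graph L ->
  (forall p, p \in L -> exists2 h, h \in H & p \subset h) ->
  #|H| <= c * n ^ 2 -> 2 < m -> 0 < n ->
  'C(m, 2) * (2 * #|L|) <=
    n ^ 2 * ex m E + n * ('C(m, 2) + 'C(m, 3) * (c * r ^ 3)) * 'C(m, 2).
Proof.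
move=> gE Hfree uH gL LH leH m_gt2 n_gt0.
have exM (G : {set {set 'I_m}}) : is_graph G -> ~~ contains_copy E G -> #|G| <= ex m E.
  exact: leq_ex.
have := sum_pullback_le gE Hfree LH exM; rewrite sum_pullback // !card_ord => le1.
have := card_bad_maps 'I_m uH; rewrite !card_ord => le2.
rewrite -(leq_pmul2r (_ : 0 < n ^ (m - 2))) ?expn_gt0 ?n_gt0 //.
rewrite mulnDl mulnA in le1 *.
apply: leq_trans le1 _; apply: leq_add.
  rewrite mulnAC leq_mul2r -expnD subnKC ?leqnn ?orbT //; exact: ltnW.
rewrite [leqRHS]mulnAC leq_mul2r; apply/orP; right.
apply: leq_trans le2 _.
have -> : n ^ (m - 2) = n * n ^ (m - 3) by rewrite -expnS; congr (_ ^ _); lia.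
move: leH; set x := n ^ (m - 3); set b2 := 'C(m, 2); set b3 := 'C(m, 3); set s := r ^ 3.
move=> leH; have : b3 * (#|H| * (s * x)) <= b3 * (c * n ^ 2 * (s * x)).
  by rewrite leq_mul2l leq_mul2r leH !orbT.
by rewrite -mulnn; nia.
Qed.

Lemma card_shadow_le (T : finType) (E : {set {set T}}) (r c : nat) (eps : rat) :
  is_graph E -> (0 < eps)%R ->
  exists N, forall n (H L : {set {set 'I_n}}), N <= n ->
    ~~ contains_berge E H -> is_uniform r H -> is_graph L ->
    (forall p, p \in L -> exists2 h, h \in H & p \subset h) ->
    #|H| <= c * n ^ 2 -> (#|L|%:R <= (ex n E)%:R + eps * (n ^ 2)%:R :> rat)%R.
Proof.
move=> gE eps_gt0.
pose b n : rat := ((ex n E)%:R / 'C(n, 2)%:R)%R.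
have b_ge0 n : (0 <= b n)%R by rewrite divr_ge0.
(* The sample size [m] is fixed here, before [n], with the density [b m] almost minimal among all
   later densities. *)
have [m m_gt2 bm] := almost_min 3 b_ge0 eps_gt0.
pose K := 'C(m, 2) + 'C(m, 3) * (c * r ^ 3).
(* This ensures [K + 1 <= eps * n]. The sampling error is [n * K]; the further 1 pays for replacing
   [n ^ 2] by [n * (n - 1)] in front of [b n <= 1]. *)
exists (maxn m (Num.bound (K.+1%:R / eps : rat)%R)).
move=> n H L; rewrite geq_max => /andP[le_mn le_Kn] Hfree uH gL LH leH.
have n_gt1 : 1 < n by apply: leq_trans le_mn; apply: ltnW.
have := shadow_average gE Hfree uH gL LH leH m_gt2 (ltnW n_gt1).
rewrite -/K -(ler_nat rat) natrD !natrM => avg.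
have Cm_gt0 : (0 < 'C(m, 2)%:R :> rat)%R by rewrite ltr0n bin_gt0 ltnW.
have Cn_gt0 : (0 < 'C(n, 2)%:R :> rat)%R by rewrite ltr0n bin_gt0.
have exb k : (0 < 'C(k, 2)%:R :> rat)%R -> ((ex k E)%:R = b k * 'C(k, 2)%:R)%R.
  by move=> C_gt0; rewrite /b divfK // gt_eqF.
have {}avg : (2 * #|L|%:R <= (n ^ 2)%:R * b m + n%:R * K%:R :> rat)%R.
  rewrite -(ler_pM2l Cm_gt0); apply: le_trans avg _.
  by rewrite exb // le_eqVlt; apply/orP; left; apply/eqP; ring.
have bn_le1 : (b n <= 1)%R.
  by rewrite ler_pdivrMr // mul1r ler_nat ex_leq_bin.
have binE : ('C(n, 2)%:R * 2 = n%:R * (n%:R - 1) :> rat)%R.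
  have := bin_ffact n 2; rewrite ffactnSr ffactn1 => /(congr1 (fun k => k%:R%R : rat)).
  by rewrite !natrM natrB // ltnW.
have exE := exb n Cn_gt0.
have bmn := bm n le_mn.
have Kn : (K%:R + 1 <= eps * n%:R :> rat)%R.
  rewrite natr1 mulrC -ler_pdivrMr //; apply/ltW.
  apply: lt_le_trans (archi_boundP _) _; first by rewrite divr_ge0 // ltW.
  by rewrite ler_nat.
have n_ge0 : (0 <= n%:R :> rat)%R by [].
rewrite natrX in avg *.
have Kn2 := ler_wpM2l n_ge0 Kn.
have bmn2 := ler_wpM2l (mulr_ge0 n_ge0 n_ge0) bmn.
have bn2 := ler_wpM2l n_ge0 bn_le1.
have exE2 : ((ex n E)%:R * 2 = b n * (n%:R * (n%:R - 1)))%R by rewrite -binE exE; ring.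
nra.
Qed.

Lemma leq_ex_clique (n s : nat) (T : finType) (E : {set {set T}}) (G : {set {set 'I_n}}) :
  is_graph G -> ~~ contains_copy E G -> num_cliques s G <= ex_clique n s E.
Proof.
by move=> gG freeG; rewrite /ex_clique (bigop.bigmax_sup G) // gG.
Qed.

(** * Hyperedges charged to triangles *)

(** For a two-element [p], this makes [y] the middle vertex of a heavy path between the ends of
    [p]. *)
Definition roof (U : finType) (m : nat) (H : {set {set U}}) (p : {set U}) (y : U) : bool :=
  (y \notin p) && [forall a in p, [set a; y] \in heavy m H].

Definition roofed (U : finType) (m : nat) (H : {set {set U}}) : {set {set U}} :=
  [set p in light m H | [exists y, roof m H p y]].

(** In the triangle on [y'] and [p'], both sides through [y'] are heavy. The light pair [p]
    therefore avoids [y'], which leaves only [p']. *)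
Lemma roof_inj (U : finType) m (H : {set {set U}}) (p p' : {set U}) (y y' : U) :
  p \in light m H -> p' \in light m H -> roof m H p' y' -> y |: p = y' |: p' -> p = p'.
Proof.
move=> pL p'L /andP[y'p' /forall_inP hv] tri_eq.
have p2 := graph_card2 (light_graph m H) pL.
have p'2 := graph_card2 (light_graph m H) p'L.
have sub z : z \in p -> z = y' \/ z \in p'.
  move=> zp; have : z \in y' |: p' by rewrite -tri_eq inE zp orbT.
  by rewrite in_setU1 => /predU1P.
have y'p : y' \notin p.
  apply/negP => y'p; have /cards1P[a aE] : #|p :\ y'| == 1.
    by move: p2; rewrite (cardsD1 y') y'p add1n => -[->].
  have : a \in p :\ y' by rewrite aE set11.
  rewrite !inE => /andP[nay' ap].
  have ap' : a \in p' by case: (sub a ap) => // ay'; rewrite ay' eqxx in nay'.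
  apply: (light_heavyF pL); have := hv a ap'.
  suff -> : [set a; y'] = p by [].
  apply/eqP; rewrite eqEcard subUset !sub1set ap y'p p2 cards2 nay' //.
apply/eqP; rewrite eqEcard p2 p'2 leqnn andbT; apply/subsetP => z zp.
by case: (sub z zp) => // zy'; rewrite zy' (negPf y'p) in zp.
Qed.

(* Choose a roofed pair [pr h] in each such hyperedge.  The chosen pairs have
   distinct representatives among the hyperedges, so adding them to the heavy graph
   keeps it [F]-free, and each of them is the only light pair of its own triangle. *)
Lemma card_roofed_hyperedges (T : finType) n (E : {set {set T}}) (H : {set {set 'I_n}}) :
  0 < #|E| -> ~~ contains_berge E H ->
  #|[set h in H | [exists p in roofed #|E| H, p \subset h]]| <=
    #|E|.-1 * ex_clique n 3 E.
Proof.
move=> E_gt0 Hfree; set m := #|E|; set B := [set h in H | _].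
pose pr (h : {set 'I_n}) := odflt set0 [pick p in roofed m H | p \subset h].
have prP h : h \in B -> pr h \in roofed m H /\ pr h \subset h.
  rewrite inE => /andP[_ /exists_inP[p pR ph]].
  by rewrite /pr; case: pickP => [? /andP[]//|/(_ p)]; rewrite pR ph.
pose P := pr @: B.
have PR p : p \in P -> p \in roofed m H by case/imsetP => h /prP[? _] ->.
have PL p : p \in P -> p \in light m H by move/PR; rewrite inE => /andP[].
pose g p := odflt set0 [pick h in B | pr h == p].
have gP p : p \in P -> g p \in B /\ pr (g p) = p.
  case/imsetP => h hB ->; rewrite /g; case: pickP => [h' /andP[? /eqP] //|/(_ h)].
  by rewrite hB eqxx.
have Gfree : ~~ contains_copy E (heavy m H :|: P).
  apply: (heavyU_free (g := g)) => //.
    by move=> p q /gP[_ {2}<-] /gP[_ {2}<-] ->.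
  move=> p /gP[gB]; have [_] := prP _ gB; move=> /[swap] ->.
  by move: gB; rewrite inE => /andP[].
have Ggraph : is_graph (heavy m H :|: P).
  apply/forall_inP => p; rewrite inE => /orP[|/PL]; rewrite inE; by case/andP.
(* A chosen pair is light, so at most [m.-1] hyperedges contain it, which bounds the fibres of
   [pr]. *)
apply: (@leq_trans (m.-1 * #|P|)).
  rewrite -sum1_card (partition_big pr (mem P)) /=; last by move=> h; apply: imset_f.
  rewrite mulnC -sum_nat_const; apply: leq_sum => p pP.
  have := PL p pP; rewrite inE => /and3P[_ _ lt_m].
  rewrite sum1_card -ltnS prednK //; apply: leq_ltn_trans lt_m.
  apply: subset_leq_card; apply/subsetP => h /andP[hB /eqP <-].
  rewrite inE; have [_ ->] := prP h hB; rewrite andbT.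
  by move: hB; rewrite inE => /andP[].
rewrite leq_mul2l; apply/orP; right.
apply: leq_trans (leq_ex_clique 3 Ggraph Gfree).
pose tri p := odflt set0 [pick t | [exists y, roof m H p y && (t == y |: p)]].
have triP p : p \in P -> exists2 y, roof m H p y & tri p = y |: p.
  move=> /PR; rewrite inE => /andP[_ /existsP[y yp]]; rewrite /tri.
  case: pickP => [t /existsP[z /andP[zp /eqP ->]]|/(_ (y |: p))/existsP[]].
    by exists z.
  by exists y; rewrite yp eqxx.
rewrite -(card_in_imset (f := tri) (D := mem P)); last first.
  move=> p q pP qP; have [y _ ->] := triP p pP; have [z zq ->] := triP q qP.
  by apply: roof_inj zq; apply: PL.
apply: subset_leq_card; apply/subsetP => _ /imsetP[p pP ->].
have [y /andP[yp /forall_inP hv] ->] := triP p pP.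
have p2 := graph_card2 (light_graph m H) (PL p pP).
rewrite inE cardsU1 yp p2 /=.
apply/forall_inP => a; rewrite in_setU1 => ap; apply/forall_inP => b.
rewrite in_setU1 => bp; apply/implyP => nab; rewrite inE.
case/predU1P: ap bp nab => [->|ap] /predU1P[->|bp] nab.
- by rewrite eqxx in nab.
- by rewrite setUC hv.
- by rewrite hv.
- suff -> : [set a; b] = p by rewrite pP orbT.
  by apply/eqP; rewrite eqEcard subUset !sub1set ap bp p2 cards2 nab.
Qed.

(** * The remaining hyperedges, counted through their light pairs *)

(** Being equal or heavy is an equivalence relation on [h]. Its classes are heavy cliques, with
    fewer than [#|T|] vertices as the heavy graph is F-free, and fewer than [r] as [h] is not a
    heavy clique; hence the bound [k]. Pairs across classes are light. *)
Lemma card_light_in_hyperedge (T U : finType) (E : {set {set T}}) (H : {set {set U}}) h r k :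
  is_graph E -> ~~ contains_berge E H -> h \in H -> #|h| = r ->
  k = minn (r - 1) (#|T| - 1) ->
  ~~ is_clique (heavy #|E| H) h ->
  ~~ [exists p in roofed #|E| H, p \subset h] ->
  k * (r - k) <= #|[set p in light #|E| H | p \subset h]|.
Proof.
move=> gE Hfree hH hr kE not_clique not_roofed.
set m := #|E| in not_clique not_roofed *.
pose R x y := (x == y) || ([set x; y] \in heavy m H).
have Rsym : symmetric R by move=> x y; rewrite /R eq_sym setUC.
have Rtr : {in h & &, transitive R}.
  move=> y x z yh xh zh; rewrite /R.
  case: eqVneq => [->//|nxy] /= xy; case: (eqVneq y z) => [<-|nyz] /=.
    by rewrite xy orbT.
  (* If [x] and [z] did not form a heavy pair, they would form a light one inside [h], roofed by
     [y]. *)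
  move=> yz; case: eqVneq => //= nxz; apply: contraR not_roofed => nheavy.
  apply/exists_inP; exists [set x; z]; last by rewrite subUset !sub1set xh zh.
  rewrite inE (pair_heavy_light hH) //=; apply/existsP; exists y.
  rewrite /roof !inE negb_or eq_sym nxy nyz /=.
  apply/forall_inP => a; rewrite in_set2 => /orP[]/eqP-> //.
  by rewrite setUC.
have clqR (S : {set U}) : {in S &, forall x y, R x y} -> is_clique (heavy m H) S.
  move=> RS; apply/forall_inP => x xS; apply/forall_inP => y yS; apply/implyP.
  by move=> /negPf nxy; have := RS x y xS yS; rewrite /R nxy.
have h_gt0 : 0 < #|h|.
  apply/card_gt0P; have /forall_inPn[x xh _] := not_clique; by exists x.
have le_class : {in h, forall x, #|[set y in h | R x y]| <= k}.
  move=> x xh; set cl := [set y in h | R x y].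
  have cl_h : cl \subset h by apply/subsetP => y; rewrite inE => /andP[].
  have cl_clique : is_clique (heavy m H) cl.
    apply: clqR => y z; rewrite !inE => /andP[yh xy] /andP[zh xz].
    by apply: (Rtr x) => //; rewrite Rsym.
  have lt_T : #|cl| < #|T|.
    rewrite ltnNge; apply: contra (heavy_free Hfree); exact: clique_copy.
  have lt_h : #|cl| < #|h|.
    apply: proper_card; rewrite properEneq cl_h andbT.
    by apply: contraNneq not_clique => <-.
  rewrite kE leq_min; lia.
have := @card_cross_classes _ h R k (in2W Rsym) Rtr (in1W (fun x => _)) le_class.
rewrite hr => /(_ _ _) cross.
rewrite -(leq_pmul2l (isT : 0 < 2)) -card_graph_pairs; last first.
  by apply/forall_inP => p; rewrite !inE => /andP[/andP[]].
apply: leq_trans (cross _ _) _.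
- by move=> x; rewrite /R eqxx.
- by rewrite kE; lia.
apply: subset_leq_card; apply/subsetP => -[x y]; rewrite inE /= => /and3P[xh yh].
rewrite /R negb_or => /andP[nxy nheavy].
by rewrite in_set in_set (pair_heavy_light hH) //= subUset !sub1set xh yh.
Qed.

(** Incidences are summed by pairs instead of hyperedges; each light pair has codegree at most
    [m.-1]. *)
Lemma sum_codeg_light (U : finType) m (H : {set {set U}}) :
  0 < m -> \sum_(h in H) #|[set p in light m H | p \subset h]| <= m.-1 * #|light m H|.
Proof.
move=> m_gt0.
rewrite (eq_bigr (fun h : {set U} => \sum_(p in light m H | p \subset h) 1)); last first.
  by move=> h _; rewrite -sum1_card; apply: eq_bigl => p; rewrite inE.
rewrite (exchange_big_dep (mem (light m H))) /=; last by move=> ? ? _ /andP[].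
rewrite mulnC -sum_nat_const; apply: leq_sum => p pL.
have := pL; rewrite inE => /and3P[_ _ lt_m].
rewrite -ltnS prednK //; apply: leq_ltn_trans lt_m; rewrite sum1_card.
by apply: subset_leq_card; apply/subsetP => h; rewrite !inE => /and3P[-> _ ->].
Qed.

Lemma card_hyperedges_le (T : finType) n (E : {set {set T}}) (H : {set {set 'I_n}}) r k :
  is_graph E -> 0 < #|E| -> ~~ contains_berge E H -> is_uniform r H ->
  k = minn (r - 1) (#|T| - 1) ->
  exists2 C, #|H| <= #|E|.-1 * ex_clique n 3 E + ex_clique n r E + C &
    C * (k * (r - k)) <= #|E|.-1 * #|light #|E| H|.
Proof.
move=> gE E_gt0 Hfree uH kE.
set m := #|E|.
pose A := [set h in H | is_clique (heavy m H) h].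
pose B := [set h in H | [exists p in roofed m H, p \subset h]].
(* The witness counts the hyperedges that are neither heavy cliques nor charged to a triangle. *)
exists #|H :\: (A :|: B)|.
  rewrite -(cardsID (A :|: B) H) leq_add2r.
  apply: leq_trans (subset_leq_card (subsetIr _ _)) _.
  apply: leq_trans (leq_card_setU _ _) _; rewrite addnC; apply: leq_add.
    exact: card_roofed_hyperedges.
  apply: leq_trans (leq_ex_clique r (heavy_graph m H) (heavy_free Hfree)).
  apply: subset_leq_card; apply/subsetP => h; rewrite !inE => /andP[hH ->].
  by rewrite (forall_inP uH).
rewrite -sum_nat_const.
apply: (@leq_trans (\sum_(h in H :\: (A :|: B)) #|[set p in light m H | p \subset h]|)).
  apply: leq_sum => h; rewrite !inE negb_or => /andP[/andP[nA nB] hH].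
  rewrite hH in nA nB; apply: card_light_in_hyperedge => //.
  exact/eqP/(forall_inP uH).
apply: leq_trans _ (sum_codeg_light H E_gt0).
rewrite [leqRHS](bigID (mem (H :\: (A :|: B)))) /=; apply: leq_trans _ (leq_addr _ _).
by apply: eq_leq; apply: eq_bigl => h; rewrite !inE; case: (h \in H); rewrite ?andbF.
Qed.

Lemma contains_berge_sub (T U : finType) (E : {set {set T}}) (H H' : {set {set U}}) :
  H' \subset H -> contains_berge E H' -> contains_berge E H.
Proof.
move=> /subsetP sH /existsP[phi /existsP[f /and4P[phi_inj /forall_inP fH f_inj phi_f]]].
apply/existsP; exists phi; apply/existsP; exists f; apply/and4P; split=> //.
by apply/forall_inP => e /fH/sH.
Qed.

(** The averaging bound is applied to the subfamily [H'] of hyperedges containing a light pair. It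
    has the same light pairs in its shadow, and at most [#|E|.-1] hyperedges for each of at most
    [n ^ 2] light pairs, whence the constant [c]. *)
Lemma card_light_le (T : finType) (E : {set {set T}}) (r : nat) (eps : rat) :
  is_graph E -> 0 < #|E| -> (0 < eps)%R ->
  exists N, forall n (H : {set {set 'I_n}}), N <= n ->
    ~~ contains_berge E H -> is_uniform r H ->
    (#|light #|E| H|%:R <= (ex n E)%:R + eps * (n ^ 2)%:R :> rat)%R.
Proof.
move=> gE E_gt0 eps_gt0; have [N leN] := card_shadow_le r #|E|.-1 gE eps_gt0.
exists N => n H le_Nn Hfree /forall_inP uH.
pose H' := [set h in H | 0 < #|[set p in light #|E| H | p \subset h]|].
apply: (leN n H') => //.
- apply: contra Hfree; apply: contains_berge_sub.
  by apply/subsetP => h; rewrite inE => /andP[].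
- by apply/forall_inP => h; rewrite inE => /andP[/uH].
- exact: light_graph.
- move=> p pL; have := pL; rewrite inE => /and3P[_ /card_gt0P[h] ]; rewrite inE.
  move=> /andP[hH ph] _; exists h => //; rewrite inE hH /=.
  by apply/card_gt0P; exists p; rewrite inE pL.
have light_n2 : #|light #|E| H| <= n ^ 2.
  apply: leq_trans (card_graph_bin (light_graph _ _)) _.
  rewrite card_ord -mulnn; apply: leq_trans (leq_pmulr _ (fact_gt0 2)) _.
  by rewrite bin_ffact ffactnS ffactn1 leq_mul2l leq_pred orbT.
apply: (@leq_trans (#|E|.-1 * #|light #|E| H|)); last by rewrite leq_mul2l light_n2 orbT.
apply: leq_trans _ (sum_codeg_light H E_gt0).
rewrite -sum1_card [leqRHS](bigID (mem H')) /=.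
apply: leq_trans _ (leq_addr _ _).
rewrite [leqRHS](eq_bigl (mem H')); last first.
  by move=> h /=; rewrite !inE; case: (h \in H).
by apply: leq_sum => h; rewrite inE => /andP[].
Qed.

(** * Assembling the asymptotic bound *)

Unset Implicit Arguments.
Local Open Scope ring_scope.

Theorem theorem7 (T : finType) (E : {set {set T}}) (r : nat) :
  is_graph E -> (2 <= #|T|)%N -> (2 <= r)%N ->
  let k := minn (r - 1) (#|T| - 1) in
  forall eps : rat, 0 < eps ->
  exists N : nat, forall n : nat, (N <= n)%N ->
    (ex_berge r n E)%:R <=
      (#|E|%:R - 1) * (ex_clique n 3 E)%:R
      + (ex_clique n r E)%:R
      + (#|E|%:R - 1) * (ex n E)%:R / (k * (r - k))%:R
      + eps * (n ^ 2)%:R :> rat.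
Proof.
move=> gE T_ge2 r_ge2 k eps eps_gt0.
(* Without edges the rational factor [#|E|%:R - 1] is -1. Once [n >= #|T|], every injection is then
   a copy, so all the maxima are over empty families and vanish. *)
have [E0|E_gt0] := posnP #|E|.
  exists #|T| => n le_Tn.
  have [phi phi_inj _] := @embed_into T 'I_n setT ltac:(by rewrite cardsT card_ord).
  have copy (G : {set {set 'I_n}}) : contains_copy E G.
    apply/existsP; exists phi; apply/andP; split; first exact/injectiveP.
    by apply/forall_inP => e; rewrite (cards0_eq E0) inE.
  have berge (H : {set {set 'I_n}}) : contains_berge E H.
    apply: (greedy_berge (phi := phi) (D := E) (g := fun=> set0)) => // e.
    - by rewrite (cards0_eq E0) inE.
    - by rewrite (cards0_eq E0) inE.
    - by move=> ->.
  rewrite /ex_berge /ex_clique /ex !big_pred0; try by move=> G; rewrite ?copy ?berge andbF.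
  by rewrite !mulr0 mul0r !add0r mulr_ge0 // ltW.
have k_r : (0 < k < r)%N by rewrite /k; lia.
have kk_gt0 : (0 < k * (r - k))%N by rewrite muln_gt0; lia.
have kk_ge1 : 1 <= (k * (r - k))%:R :> rat by rewrite ler1n.
have Er_gt0 : 0 < #|E|%:R :> rat by rewrite ltr0n.
(* The error in the number of light pairs is later multiplied by [#|E| - 1] and divided by
   [k * (r - k) >= 1]; taking [eps / #|E|] keeps it below [eps]. *)
have [N leN] := card_light_le r gE E_gt0 (divr_gt0 eps_gt0 Er_gt0).
exists N => n /leN light_le.
have E1_ge0 : 0 <= #|E|%:R - 1 :> rat by rewrite subr_ge0 ler1n.
rewrite /ex_berge; elim/big_ind: _ => [|x y lex ley|H /andP[uH Hfree]].
- by rewrite !addr_ge0 ?divr_ge0 ?mulr_ge0 // ltW.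
- by rewrite /maxn; case: ifP.
have [C leH leC] := card_hyperedges_le gE E_gt0 Hfree uH (erefl k).
rewrite -(ler_nat rat) !natrD natrM in leH.
rewrite -(ler_nat rat) (natrM _ C) (natrM _ #|E|.-1) in leC.
have E1 : (#|E|.-1)%:R = #|E|%:R - 1 :> rat by rewrite -subn1 natrB.
rewrite {}E1 in leH leC.
apply: (le_trans leH); rewrite -[leRHS]addrA lerD2l.
have {}light_le := light_le H Hfree uH.
have kk_gt0' : 0 < (k * (r - k))%:R :> rat by rewrite ltr0n.
rewrite -ler_pdivlMr // in leC.
apply: le_trans leC _.
apply: (@le_trans _ _ ((#|E|%:R - 1) * ((ex n E)%:R + eps / #|E|%:R * (n ^ 2)%:R) /
                         (k * (r - k))%:R)).
  by rewrite ler_pM2r ?invr_gt0 // ler_wpM2l.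
rewrite mulrDr [leLHS]mulrDl lerD2l.
rewrite ler_pdivrMr //.
have n2_ge0 : 0 <= (n ^ 2)%:R :> rat by [].
apply: (@le_trans _ _ (eps * (n ^ 2)%:R)); last first.
  by rewrite ler_peMr // mulr_ge0 // ltW.
rewrite mulrA ler_wpM2r // mulrCA ger_pMr // ler_pdivrMr //; lra.
Qed.
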